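(* Let $X$ be the set of feasible points defined by $Ax=b$, $x_j\ge 0$ and $x_j\in\mathbb{Z}$ for all $j\in\{1,\dots,n\}$. Let the individual objectives be $f_i(x)=\sum_{j=1}^n c_{ij}x_j$ with $c_{ij}\in\mathbb{Z}$ for all $i\in\{1,\dots,k\}$ and $j\in\{1,\dots,n\}$. Let the nonlinear utility function $G(f_1(x),\dots,f_k(x))$ be continuous and strictly increasing in each individual objective function $f_1(x),\dots,f_k(x)$. Then Algorithm 1 (described in the context) finds the minimum value of $G(f_1(x),f_2(x),\dots,f_k(x))$ among all integer efficient points for the multi-objective integer programming problem of minimising $f_1(x),\dots,f_k(x)$ subject to $x\in X$; that is, it terminates with $G^{BEST}$ equal to this minimum. It also identifies a corresponding $x\in X$ that attains this minimum.
   Context: **Efficiency.** A point $x'\in X$ is called $k$-objective efficient (an integer efficient point of the problem) if and only if there is no $x\in X$ such that $f_i(x)\le f_i(x')$ for each $i\in\{1,\dots,k\}$ and $f_i(x)<f_i(x')$ for at least one $i$. The resulting objective vector $(f_1(x'),\dots,f_k(x'))$ is then called $k$-objective nondominated. The same notions apply to a problem with $k-1$ objectives, using only those objectives and that problem's feasible set. **Algorithm 1.** The algorithm maintains $G^{BEST}$, the best known value of the utility function, and $f_i^{LB}$ and $f_i^{UB}$, the current lower and upper bounds on the values of the individual objective functions. Each time $G^{BEST}$ is updated, the corresponding $x\in X$ can be recorded. Steps are carried out in order unless otherwise directed. *Step 0.* Find some initial set of points $I$ (points of $X$). Initialise $G^{BEST}=\min_{x\in I}G(f_1(x),\dots,f_k(x))$.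 Solve Min $f_i(x)$ s.t. $x\in X$ for each $i\in\{1,\dots,k\}$. Set each $f_i^{LB}$ to the corresponding optimal objective value. Set each $f_i^{UB}$ to $\infty$. *Step 1.* If $G(f_1^{LB},\dots,f_k^{LB})\ge G^{BEST}$ then STOP. For each objective $i\in\{1,\dots,k\}$, find $f_i^A$ that solves $$G(f_1^{LB},\dots,f_{i-1}^{LB},f_i^A,f_{i+1}^{LB},\dots,f_k^{LB})=G^{BEST}.$$ If this is impossible because $G(f_1^{LB},\dots,f_{i-1}^{LB},z,f_{i+1}^{LB},\dots,f_k^{LB})<G^{BEST}$ for all $z$, set $f_i^A=\infty$. Set $f_i^{UB}=\min(\lfloor f_i^A\rfloor,f_i^{UB})$ for each $i\in\{1,\dots,k\}$. *Step 2.* For each objective $i\in\{1,\dots,k\}$: solve the LP relaxation of $$\text{Min } f_i(x)\ \text{ s.t. } x\in X,\ f_1(x)\le f_1^{UB},\ f_2(x)\le f_2^{UB},\ \dots,\ f_k(x)\le f_k^{UB}.$$ Let $f_i^{LP}=f_i(x^* )$ be the optimal objective value and $x^*$ the corresponding optimal solution, and set $f_i^{LB}=\lceil f_i^{LP}\rceil$. If $x^*$ is integer and $G(f_1(x^* ),\dots,f_k(x^* ))<G^{BEST}$, set $G^{BEST}=G(f_1(x^* ),\dots,f_k(x^* ))$. After this, if the lower bound $f_i^{LB}$ is updated for any objective $i$ then go to Step 1. *Step 3.* Use the algorithm of Özlen and Azizoğlu (2009), which generates all nondominated objective vectors of a multi-objective integer programming problem by recursively identifying upper bounds on individual objectives using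 problems with fewer objectives, to update the upper bound $f_k^{UB}$. Specifically: begin generating all nondominated objective vectors for the $(k-1)$-objective integer programming problem $$\text{Min } f_1(x),f_2(x),\dots,f_{k-1}(x)\ \text{ s.t. } x\in X,\ f_1(x)\le f_1^{UB},\ f_2(x)\le f_2^{UB},\ \dots,\ f_k(x)\le f_k^{UB}.$$ Each time a $(k-1)$-objective vector is generated, fix the first $k-1$ objectives to the values found and minimise $f_k(x)$. This two-step ''lexicographic optimisation'' yields a $k$-objective nondominated objective vector for the original problem. If no feasible point exists then STOP. Each time a nondominated $k$-objective vector $f^*$ is generated, test whether $G(f_1^*,\dots,f_k^* )<G^{BEST}$; if true, set $G^{BEST}=G(f_1^*,\dots,f_k^* )$ and go to Step 1 immediately. Let $S$ be the set of all nondominated objective vectors that were generated above. Set $f_k^{UB}=\max_{f\in S}f_k-1$ and go to Step 2. *)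

(* Defs.v *)
From HB Require Import structures.
From mathcomp Require Import all_boot all_order all_algebra.
From mathcomp Require Import all_classical all_reals all_analysis.
From Stdlib Require Import Relation_Operators.

Set Implicit Arguments.
Unset Strict Implicit.
Unset Printing Implicit Defensive.

Import Order.TTheory GRing.Theory Num.Theory.
Import numFieldNormedType.Exports.
Local Open Scope classical_set_scope.
Local Open Scope ring_scope.

Section Utility.
Variables (R : realType) (K : nat) (G : 'rV[R]_K -> R).

Definition increasing_in_each : Prop :=
  forall (i : 'I_K) (u v : 'rV[R]_K),
    (forall j, j != i -> u 0 j = v 0 j) -> u 0 i < v 0 i -> G u < G v.

(* [a] is where G, starting from [lb] and moving along axis [i], reaches the
   value [gbest]; it is +oo when G stays below [gbest] on the whole line. *)
Definition axis_bound (gbest : R) (lb : 'rV[R]_K) (i : 'I_K) (a : \bar R)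
    : Prop :=
  let at_ z := \row_j (if j == i then z else lb 0 j) in
  match a with
  | EFin z => G (at_ z) = gbest
  | +oo%E => forall z, G (at_ z) < gbest
  | -oo%E => False
  end.

End Utility.

Definition argmin (T : Type) (R : realType) (h : T -> R) (D : set T) (x : T)
    : Prop := D x /\ forall y, D y -> h x <= h y.

Definition is_minimum (T : Type) (R : realType) (h : T -> R) (D : set T)
    (v : R) : Prop := exists2 x, argmin h D x & h x = v.

(* There are [k.+1] objectives, so that the last one, which the algorithm
   singles out, is always [ord_max].  Points are real column vectors, so that integer points and
   solutions of LP relaxations live in the same type. *)
Section Problem.
Variables (R : realType) (m n k : nat).
Variables (A : 'M[R]_(m, n)) (b : 'cV[R]_m) (c : 'M[int]_(k.+1, n)).

Definition integral (x : 'cV[R]_n) : bool := [forall j, x j 0 \is a Num.int].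

Definition lp_feasible : set 'cV[R]_n :=
  [set x | A *m x = b /\ forall j, 0 <= x j 0].

Definition feasible : set 'cV[R]_n := [set x | lp_feasible x /\ integral x].

Definition obj (i : 'I_k.+1) (x : 'cV[R]_n) : R :=
  \sum_(j < n) (c i j)%:~R * x j 0.

Definition objs (x : 'cV[R]_n) : 'rV[R]_k.+1 := \row_i obj i x.

(* [J] is the set of objectives taken into account, [D] the feasible set. *)
Definition efficient (J : pred 'I_k.+1) (D : set 'cV[R]_n) (x : 'cV[R]_n)
    : Prop :=
  D x /\ ~ (exists y, [/\ D y, forall i, J i -> obj i y <= obj i x
                       & exists2 i, J i & obj i y < obj i x]).

Definition bounded_by (ub : 'I_k.+1 -> \bar R) (D : set 'cV[R]_n)
    : set 'cV[R]_n :=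
  [set x | D x /\ forall i, ((obj i x)%:E <= ub i)%E].

Record state := State {
  gbest : R;
  xbest : 'cV[R]_n;
  lb : 'rV[R]_k.+1;
  ub : 'I_k.+1 -> \bar R }.

(* In [AtStep3 s S], [S] lists the nondominated vectors generated since control
   last entered that step. *)
Inductive config :=
| Start
| AtStep1 of state
| AtStep2 of state
| AtStep3 of state & seq 'rV[R]_k.+1
| Stopped of state.

Variable G : 'rV[R]_k.+1 -> R.

(* [None] is the case where the LP has no optimal solution (it is infeasible
   or unbounded); the bound of that objective is then left unchanged. *)
Definition lp_outcome (s : state) (i : 'I_k.+1) (o : option 'cV[R]_n) : Prop :=
  if o is Some x then argmin (obj i) (bounded_by (ub s) lp_feasible) x
  else ~ exists x, argmin (obj i) (bounded_by (ub s) lp_feasible) x.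

Definition record_best (gx : R * 'cV[R]_n) (y : 'cV[R]_n) : R * 'cV[R]_n :=
  if integral y && (G (objs y) < gx.1) then (G (objs y), y) else gx.

Definition step2_state (s : state) (xs : 'I_k.+1 -> option 'cV[R]_n) : state :=
  let gx := foldl record_best (gbest s, xbest s)
                  (pmap xs (enum 'I_k.+1)) in
  State gx.1 gx.2
        (\row_i if xs i is Some x then (Num.ceil (obj i x))%:~R else lb s 0 i)
        (ub s).

Definition but_last : pred 'I_k.+1 := fun i => i != ord_max.

Definition agree_but_last (u v : 'rV[R]_k.+1) : Prop :=
  forall i, but_last i -> u 0 i = v 0 i.

Definition sub_feasible (s : state) : set 'cV[R]_n :=
  bounded_by (ub s) feasible.

(* [x] realises the result of the two-stage lexicographic optimisation:
   [z] gives a nondominated vector for the objectives other than the last,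
   and [x] minimises the last objective with the others fixed. *)
Definition lex_optimal (s : state) (x : 'cV[R]_n) : Prop :=
  exists2 z, efficient but_last (sub_feasible s) z &
    argmin (obj ord_max)
      [set y | sub_feasible s y /\ agree_but_last (objs y) (objs z)] x.

(* One transition of the algorithm.  It is nondeterministic where the
   algorithm leaves a choice: the initial points, the optimal solutions
   returned by the solvers, and the order in which [AtStep3] enumerates the
   nondominated vectors (each of them once). *)
Inductive step : config -> config -> Prop :=
| Step0 (I : seq 'cV[R]_n) (x : 'cV[R]_n) (y : 'I_k.+1 -> 'cV[R]_n) :
    (forall z, z \in I -> feasible z) ->
    argmin (G \o objs) [set z | z \in I] x ->
    (forall i, argmin (obj i) feasible (y i)) ->
    step Start
      (AtStep1 (State (G (objs x)) x (\row_i obj i (y i)) (fun=> +oo%E)))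
| Step1_stop s :
    gbest s <= G (lb s) ->
    step (AtStep1 s) (Stopped s)
| Step1_bound s (fA : 'I_k.+1 -> \bar R) :
    G (lb s) < gbest s ->
    (forall i, axis_bound G (gbest s) (lb s) i (fA i)) ->
    step (AtStep1 s)
      (AtStep2 (State (gbest s) (xbest s) (lb s)
         (fun i => Order.min
            (er_map (fun a : R => (Num.floor a)%:~R : R) (fA i)) (ub s i))))
| Step2_again s xs :
    (forall i, lp_outcome s i (xs i)) ->
    lb (step2_state s xs) != lb s ->
    step (AtStep2 s) (AtStep1 (step2_state s xs))
| Step2_done s xs :
    (forall i, lp_outcome s i (xs i)) ->
    lb (step2_state s xs) = lb s ->
    step (AtStep2 s) (AtStep3 (step2_state s xs) [::])
| Step3_stop s :
    ~ (exists x, sub_feasible s x) ->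
    step (AtStep3 s [::]) (Stopped s)
| Step3_improve s S x :
    lex_optimal s x -> objs x \notin S ->
    G (objs x) < gbest s ->
    step (AtStep3 s S) (AtStep1 (State (G (objs x)) x (lb s) (ub s)))
| Step3_collect s S x :
    lex_optimal s x -> objs x \notin S ->
    gbest s <= G (objs x) ->
    step (AtStep3 s S) (AtStep3 s (objs x :: S))
| Step3_done s S v :
    (forall x, lex_optimal s x -> objs x \in S) ->
    v \in S -> (forall w, w \in S -> w 0 ord_max <= v 0 ord_max) ->
    step (AtStep3 s S)
      (AtStep2 (State (gbest s) (xbest s) (lb s)
         (fun i => if i == ord_max then (v 0 ord_max - 1)%:E else ub s i))).

Definition reachable : config -> Prop := clos_refl_trans config step Start.

End Problem.

(* Main.v *)
(* Correctness: throughout a run, every feasible point improving on [gbest] lies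
   in the box of the upper bounds, and every feasible point of the box lies above
   the lower bounds.  So when the algorithm stops nothing improves on [gbest], and
   by strict monotonicity of G a minimiser over X is efficient.

   Termination: objective vectors of feasible points are integral and bounded
   below, so by Dickson's lemma an infinite sequence of them has an infinite
   nondecreasing subsequence; hence [gbest] is eventually constant.  Each upper
   bound is nonincreasing, integral or infinite, and bounded below, because the
   lower bounds are; hence it is eventually constant too, and then so are the
   lower bounds.  From then on the run can only stay in Step 3, collecting
   pairwise incomparable nondominated vectors, which contradicts Dickson's
   lemma. *)
Require Import Defs.
From HB Require Import structures.
From mathcomp Require Import all_boot all_order all_algebra.
From mathcomp Require Import all_classical all_reals all_analysis.
From mathcomp Require Import lra.
Import Order.TTheory GRing.Theory Num.Theory.
Import numFieldNormedType.Exports.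
Local Open Scope classical_set_scope.
Local Open Scope ring_scope.
Set Implicit Arguments.
Unset Strict Implicit.
Unset Printing Implicit Defensive.

(** * Integer-valued functions bounded below; Dickson's lemma *)

Section IntegerValued.
Variable R : realType.

Lemma int_ltD1 (x y : R) :
  x \is a Num.int -> y \is a Num.int -> x < y -> x + 1 <= y.
Proof.
move=> /intrP[p ->] /intrP[q ->].
by rewrite -[1]/(1%:~R) -intrD ler_int ltr_int lezD1.
Qed.

(** Descent: by [int_ltD1] a point that is not minimal can be improved by at least 1, and [l] limits
    the number of such improvements. *)
Lemma int_argmin (T : Type) (h : T -> R) (D : set T) (l : R) :
  (exists x, D x) -> (forall x, D x -> h x \is a Num.int) ->
  (forall x, D x -> l <= h x) -> exists x, argmin h D x.
Proof.
move=> [x Dx] hint hl.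
have main N : forall y, D y -> h y < l + N%:R -> exists x, argmin h D x.
  elim: N => [|N IH] y Dy; first by rewrite addr0 ltNge hl.
  move=> hy; case: (pselect (exists2 z, D z & h z < h y)) => [[z Dz hz]|Hn].
    apply: (IH z Dz); have := int_ltD1 (hint _ Dz) (hint _ Dy) hz.
    by move: hy; rewrite -natr1; lra.
  exists y; split=> // z Dz; rewrite leNgt; apply/negP => hz.
  by apply: Hn; exists z.
apply: (main (Num.truncn (h x - l)).+1 x Dx).
by rewrite addrC -ltrBlDr; apply: truncnS_gt.
Qed.

(** [phi N.+1] minimises [u] over the indices beyond [phi N]; these tails are nested, so the minima
    do not decrease. *)
Lemma int_nondecreasing_subseq (u : nat -> R) (l : R) :
  (forall t, u t \is a Num.int) -> (forall t, l <= u t) ->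
  exists phi : nat -> nat, {homo phi : p q / (p < q)%N >-> (p < q)%N} /\
    {homo u \o phi : p q / (p <= q)%N >-> p <= q}.
Proof.
move=> uint ul.
have /choice[p Hp] N : exists p, argmin u [set q | (N <= q)%N] p.
  apply: (@int_argmin _ _ _ l) => //; exists N; exact: leqnn.
pose phi := fix phi N := if N is N'.+1 then p (phi N').+1 else p 0%N.
have phiS N : (phi N < phi N.+1)%N by have [] := Hp (phi N).+1.
have phi_min N q : (phi N <= q)%N -> u (phi N) <= u q.
  move=> Hq; case: N Hq => [|N] Hq /=; first by have [_] := Hp 0%N; apply.
  by have [H1 H2] := Hp (phi N).+1; apply/H2/(leq_trans H1 Hq).
have phi_homo : {homo phi : p q / (p < q)%N >-> (p < q)%N}.
  exact: (homo_ltn ltn_trans phiS).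
exists phi; split=> // i j; rewrite leq_eqVlt => /predU1P[-> //|/phi_homo/ltnW].
exact: phi_min.
Qed.

(** Subsequences are extracted for one coordinate after another; a further subsequence keeps the
    coordinates already treated nondecreasing. *)
Lemma dickson (I : finType) (f : nat -> I -> R) (l : I -> R) :
  (forall t i, f t i \is a Num.int) -> (forall t i, l i <= f t i) ->
  exists phi : nat -> nat, {homo phi : p q / (p < q)%N >-> (p < q)%N} /\
    forall i p q, (p <= q)%N -> f (phi p) i <= f (phi q) i.
Proof.
move=> fint fl.
suff [phi [Hphi H]] : exists phi : nat -> nat,
    {homo phi : p q / (p < q)%N >-> (p < q)%N} /\
    forall i, i \in enum I -> forall p q, (p <= q)%N -> f (phi p) i <= f (phi q) i.
  by exists phi; split=> // i; apply: H; rewrite mem_enum.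
elim: (enum I) => [|i s [phi [Hphi H]]]; first by exists id; split=> // i; rewrite in_nil.
have [psi [Hpsi Hi]] := @int_nondecreasing_subseq (fun t => f (phi t) i) (l i)
  (fun t => fint _ _) (fun t => fl _ _).
exists (phi \o psi); split=> [p q /Hpsi/Hphi //|j].
rewrite inE => /predU1P[->|js] p q pq /=; first exact: Hi.
apply: H => //; move: pq; rewrite leq_eqVlt => /predU1P[-> //|/Hpsi/ltnW //].
Qed.

(** If a finite value occurs from [T0] on, the least one is attained and monotonicity keeps [u]
    there; otherwise [u] stays infinite. The bound starts at [T0] because in a run the lower bounds
    are controlled only eventually. *)
Lemma int_ereal_eventually_constant (u : nat -> \bar R) (L : R) (T0 : nat) :
  (forall t, (u t.+1 <= u t)%E) ->
  (forall t, u t = +oo%E \/ exists2 z, z \is a Num.int & u t = z%:E) ->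
  (forall t, (T0 <= t)%N -> (L%:E <= u t)%E) ->
  exists T, forall t, (T <= t)%N -> u t = u T.
Proof.
move=> uS uint uL.
have umono p q : (p <= q)%N -> (u q <= u p)%E.
  by move=> /subnK <-; elim: (q - p)%N => [//|N]; apply/le_trans/uS.
case: (pselect (exists t, (T0 <= t)%N /\ u t <> +oo%E)) => [Hex|Hn]; last first.
  have uT t : (T0 <= t)%N -> u t = +oo%E.
    by move=> Tt; apply: contrapT => Ht; apply: Hn; exists t.
  by exists T0 => t Tt; rewrite !uT.
have [||p [[Tp p_fin] Hp]] := @int_argmin _ (fine \o u)
    [set t | (T0 <= t)%N /\ u t <> +oo%E] L Hex.
- by move=> t [_] /=; have [->|[z zint ->]] := uint t.
- by move=> t [/uL] /=; have [->|[z zint ->]] := uint t; rewrite ?lee_fin.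
exists p => t pt; apply/eqP; rewrite eq_le umono //=.
have [u_t|[z _ Ez]] := uint t; first by rewrite u_t leey.
have := Hp t; rewrite /= Ez.
have [/p_fin //|[w _ ->]] := uint p.
by rewrite lee_fin; apply; split=> //; apply: leq_trans pt.
Qed.

End IntegerValued.

(** * Monotonicity and continuity of the utility function *)

Section Utility.
Variables (R : realType) (K : nat) (G : 'rV[R]_K -> R).

Definition set_coord (u : 'rV[R]_K) (i : 'I_K) (z : R) : 'rV[R]_K :=
  \row_j (if j == i then z else u 0 j).

Lemma set_coordE u i z j : set_coord u i z 0 j = if j == i then z else u 0 j.
Proof. by rewrite mxE. Qed.

Lemma set_coord_id u i : set_coord u i (u 0 i) = u.
Proof. by apply/rowP => j; rewrite mxE; case: eqP => [->|]. Qed.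

Lemma set_coord_continuous u i : continuous (set_coord u i).
Proof.
rewrite (_ : set_coord u i = fun z : R => (z - u 0 i) *: delta_mx 0 i + u).
  move=> z; apply: cvgD; last exact: cvg_cst.
  apply: cvgZr_tmp. apply: cvgB; [exact: cvg_id|exact: cvg_cst].
apply/funext => z; apply/rowP => j; rewrite !mxE eqxx /=.
by case: eqP => [->|_]; rewrite ?mulr1 ?mulr0 ?subrK ?add0r.
Qed.

Hypothesis G_increasing : increasing_in_each G.

(** The hypothesis compares vectors differing in one coordinate, so the coordinates of [u] are
    raised to those of [v] one at a time, by induction on the number of disagreements. *)
Lemma increasing_le (u v : 'rV[R]_K) : (forall i, u 0 i <= v 0 i) -> G u <= G v.
Proof.
have [N] := ubnP #|[pred i | u 0 i != v 0 i]|.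
elim: N u => // N IH u /ltnSE HN uv.
have [i /= Hi|H0] := pickP [pred i | u 0 i != v 0 i]; last first.
  suff -> : u = v by [].
  by apply/rowP => i; apply/eqP/negbFE/(H0 i).
have uvi : u 0 i < v 0 i by rewrite lt_neqAle uv andbT.
apply: (@le_trans _ _ (G (set_coord u i (v 0 i)))).
  apply/ltW/(G_increasing (i := i)) => [j ji|]; rewrite set_coordE ?eqxx //.
  by rewrite (negbTE ji).
apply: IH => [|j]; last by rewrite set_coordE; case: eqP => [->|].
apply: leq_trans HN; apply/proper_card/properP; split.
  apply/fintype.subsetP => j; rewrite !inE set_coordE; have [->|//] := eqVneq j i.
  by rewrite eqxx.
by exists i; rewrite !inE // set_coordE eqxx eqxx.
Qed.

Lemma increasing_lt (u v : 'rV[R]_K) :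
  (forall i, u 0 i <= v 0 i) -> (exists i, u 0 i < v 0 i) -> G u < G v.
Proof.
move=> uv [i ui]; apply: (@lt_le_trans _ _ (G (set_coord u i (v 0 i)))).
  apply: (G_increasing (i := i)) => [j ji|]; rewrite set_coordE ?eqxx //.
  by rewrite (negbTE ji).
by apply: increasing_le => j; rewrite set_coordE; case: eqP => [->|].
Qed.

Lemma axis_bound_exists (G_continuous : continuous G) g lb i :
  G lb < g -> exists a, axis_bound G g lb i a.
Proof.
move=> Glb.
case: (pselect (forall z, G (set_coord lb i z) < g)) => [H|].
  by exists +oo%E.
move=> /existsNP[z /negP]; rewrite -leNgt => gz.
(* A [z] below [lb 0 i] would give a value of at most [G lb]; hence the intermediate value theorem
   applies between [lb 0 i] and [z]. *)
have lbz : lb 0 i <= z.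
  rewrite leNgt; apply/negP => zlb.
  have : G (set_coord lb i z) <= G lb.
    by apply: increasing_le => j; rewrite set_coordE; case: eqP => [->|//]; exact: ltW.
  by rewrite leNgt (lt_le_trans Glb gz).
have [||w _ Hw] := @IVT R (G \o set_coord lb i) (lb 0 i) z g lbz.
- apply: continuous_subspaceT => w.
  exact: continuous_comp (@set_coord_continuous lb i w) (G_continuous _).
- by rewrite /= set_coord_id ge_min le_max (ltW Glb) gz /= orbT.
by exists w%:E.
Qed.

End Utility.

(** * Efficient points and lexicographic optima *)

Section Algorithm.
Variables (R : realType) (m n k : nat).
Variables (A : 'M[R]_(m, n)) (b : 'cV[R]_m) (c : 'M[int]_(k.+1, n)).
Variable G : 'rV[R]_k.+1 -> R.
Hypothesis obj_bounded_below : forall i, exists l : R,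
  forall x, feasible A b x -> l <= obj c i x.
Hypothesis G_increasing : increasing_in_each G.

Implicit Types (s : state R n k) (cf : config R n k) (x y z : 'cV[R]_n).

Lemma obj_int i x : feasible A b x -> obj c i x \is a Num.int.
Proof.
move=> [_ /forallP xint]; apply: rpred_sum => j _.
by apply: rpredM; [exact: intr_int|exact: xint].
Qed.

Lemma objs_le x y : (forall i, obj c i x <= obj c i y) -> G (objs c x) <= G (objs c y).
Proof. by move=> xy; apply: increasing_le => // i; rewrite !mxE. Qed.

Lemma feasible_argmin i (D : set 'cV[R]_n) :
  D `<=` feasible A b -> (exists x, D x) -> exists x, argmin (obj c i) D x.
Proof.
move=> DX Dne; have [l Hl] := obj_bounded_below i.
by apply: (@int_argmin _ _ _ _ l) => // x /DX; [exact: obj_int|exact: Hl].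
Qed.

Lemma sub_feasibleS s : sub_feasible A b c s `<=` feasible A b.
Proof. by move=> x []. Qed.

Lemma bounded_by_ub (u v : 'I_k.+1 -> \bar R) D : (forall i, (u i <= v i)%E) ->
  bounded_by c u D `<=` bounded_by c v D.
Proof. by move=> uv x [Dx xu]; split=> // i; apply: le_trans (uv i). Qed.

(** Among the points of [D] weakly below [y] on [J], one minimising the sum of the objectives in [J]
    is efficient: a dominating point would have a smaller sum. *)
Lemma efficient_below (J : pred 'I_k.+1) (D : set 'cV[R]_n) y :
  D `<=` feasible A b -> D y ->
  exists2 z, efficient c J D z & forall i, J i -> obj c i z <= obj c i y.
Proof.
move=> DX Dy; have /choice[l Hl] := obj_bounded_below.
have [|||z [[Dz zy] zmin]] := @int_argmin R _ (fun x => \sum_(i | J i) obj c i x)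
    [set x | D x /\ forall i, J i -> obj c i x <= obj c i y] (\sum_(i | J i) l i).
- by exists y.
- by move=> x [/DX Xx _]; apply: rpred_sum => i _; exact: obj_int.
- by move=> x [/DX Xx _]; apply: ler_sum => i _; exact: Hl.
exists z => //; split=> // -[w [Dw wz [i Ji wi]]].
have : \sum_(j | J j) obj c j w < \sum_(j | J j) obj c j z.
  rewrite (bigD1 i) //= [ltRHS](bigD1 i) //=.
  by apply: ltr_leD => //; apply: ler_sum => j /andP[Jj _]; exact: wz.
rewrite ltNge => /negP; apply; apply: (zmin w).
by split=> // j Jj; apply: le_trans (wz j Jj) (zy j Jj).
Qed.

Lemma lex_optimal_feasible s x :
  lex_optimal A b c s x -> sub_feasible A b c s x.
Proof. by case=> z _ [[]]. Qed.

(** A dominating point either improves an objective other than the last, against the efficiency of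
    [z], or ties with [x] on all of these and improves the last, against the minimality of [x]. *)
Lemma lex_optimal_efficient s x :
  lex_optimal A b c s x -> efficient c predT (sub_feasible A b c s) x.
Proof.
move=> [z [Dz zeff] [[Dx xz] xmin]]; split=> // -[y [Dy yx [i _ yi]]].
have xzE j : but_last j -> obj c j x = obj c j z.
  by move=> /xz; rewrite !mxE.
case: (pselect (exists2 j, but_last j & obj c j y < obj c j x)) => [[j bj yj]|Hn].
  apply: zeff; exists y; split=> // [l bl|]; first by rewrite -xzE ?yx.
  by exists j; rewrite // -xzE.
have yE j : but_last j -> obj c j y = obj c j x.
  move=> bj; apply/eqP; rewrite eq_le yx //= leNgt; apply/negP => yj.
  by apply: Hn; exists j.
have [iE|ni] := eqVneq i ord_max; last by move: yi; rewrite yE ?ltxx.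
move: yi; rewrite iE ltNge => /negP; apply; apply: xmin.
by split=> // j bj; rewrite !mxE yE ?xzE.
Qed.

(** Serves to dominate the points cut off by Step 3, and to show that Step 3 finds a vector whenever
    the box has a feasible point. *)
Lemma lex_optimal_below s y : sub_feasible A b c s y ->
  exists2 x, lex_optimal A b c s x &
    forall i, but_last i -> obj c i x <= obj c i y.
Proof.
move=> Dy; have [z zeff zy] := efficient_below (@but_last k) (@sub_feasibleS s) Dy.
have [||x Hx] := @feasible_argmin ord_max
  [set w | sub_feasible A b c s w /\ agree_but_last (objs c w) (objs c z)].
- by move=> w [/sub_feasibleS].
- by exists z; split=> //; case: zeff.
exists x; first by exists z.
by move=> i bi; move: Hx => [[_ /(_ i bi)]]; rewrite !mxE => -> _; exact: zy.
Qed.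

(** * Invariant and partial correctness *)

(** The lower bounds are asserted only inside the box, since the LPs of Step 2 are solved there;
    integrality of the bounds serves termination. *)
Record valid s : Prop := Valid {
  xbest_feasible : feasible A b (xbest s);
  gbestE : gbest s = G (objs c (xbest s));
  improving_in_box : forall y, feasible A b y -> G (objs c y) < gbest s ->
    forall i, ((obj c i y)%:E <= ub s i)%E;
  lb_le : forall y, sub_feasible A b c s y -> forall i, lb s 0 i <= obj c i y;
  lb_int : forall i, lb s 0 i \is a Num.int;
  ub_int : forall i, ub s i = +oo%E \/ exists2 z, z \is a Num.int & ub s i = z%:E }.

Definition collected s (V : seq 'rV[R]_k.+1) : Prop :=
  forall v, v \in V ->
    gbest s <= G v /\ exists2 x, lex_optimal A b c s x & objs c x = v.

Definition valid_config cf : Prop :=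
  match cf with
  | Start => True
  | AtStep1 s | AtStep2 s => valid s
  | AtStep3 s V => valid s /\ collected s V
  | Stopped s => valid s /\ forall y, feasible A b y -> gbest s <= G (objs c y)
  end.

Lemma valid_improving s y : valid s -> feasible A b y -> G (objs c y) < gbest s ->
  sub_feasible A b c s y.
Proof. by move=> vs Xy /(improving_in_box vs Xy). Qed.

Lemma foldl_record_best (ys : seq 'cV[R]_n) (gx : R * 'cV[R]_n) :
  (forall y, y \in ys -> lp_feasible A b y) ->
  feasible A b gx.2 -> gx.1 = G (objs c gx.2) ->
  let gx' := foldl (record_best c G) gx ys in
  [/\ feasible A b gx'.2, gx'.1 = G (objs c gx'.2) & gx'.1 <= gx.1].
Proof.
elim: ys gx => [//|y ys IH] gx Hys Xgx Egx /=.
have [|||H1 H2 H3] := IH (record_best c G gx y).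
- by move=> z zs; apply: Hys; rewrite inE zs orbT.
- rewrite /record_best; case: ifP => // /andP[yint _].
  by split=> //=; apply: Hys; rewrite mem_head.
- by rewrite /record_best; case: ifP.
split=> //; apply: (le_trans H3); rewrite /record_best.
by case: ifP => // /andP[_ /ltW].
Qed.

Lemma step2_best s xs : valid s -> (forall i, lp_outcome A b c s i (xs i)) ->
  let s' := step2_state c G s xs in
  [/\ feasible A b (xbest s'), gbest s' = G (objs c (xbest s')) & gbest s' <= gbest s].
Proof.
move=> vs Hxs; apply: foldl_record_best => /=; last 2 first.
- exact: xbest_feasible.
- exact: gbestE.
move=> y; rewrite mem_pmap => /mapP[i _ Ei]; have := Hxs i.
by rewrite -Ei => -[[]].
Qed.

Lemma step2_lbE s xs i : lb (step2_state c G s xs) 0 i =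
  if xs i is Some x then (Num.ceil (obj c i x))%:~R else lb s 0 i.
Proof. by rewrite mxE. Qed.

Lemma valid_step2 s xs : valid s -> (forall i, lp_outcome A b c s i (xs i)) ->
  valid (step2_state c G s xs).
Proof.
move=> vs Hxs; have [H1 H2 H3] := step2_best vs Hxs; split=> //.
- move=> y Xy yg; apply: (improving_in_box vs Xy); exact: lt_le_trans yg H3.
- move=> y Dy i; rewrite step2_lbE; have := Hxs i.
  case: (xs i) => [x [_ xmin]|_]; last exact: lb_le.
  have Xy := sub_feasibleS Dy.
  (* An integer above the LP optimum is also above its ceiling. *)
  have := xmin y; rewrite -[obj c i y]floorK ?obj_int // ler_int ceil_le_int.
  by apply; case: Dy => -[].
- move=> i; rewrite step2_lbE; case: (xs i) => [x|]; first exact: intr_int.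
  exact: lb_int.
- by move=> i; exact: (ub_int vs).
Qed.

Lemma axis_bound_gt_lb s i a : G (lb s) < gbest s ->
  axis_bound G (gbest s) (lb s) i a -> ((lb s 0 i)%:E < a)%E.
Proof.
case: a => [z| |] //= Hg; last by rewrite ltry.
move=> Hz; rewrite lte_fin ltNge; apply/negP => zlb.
suff: G (set_coord (lb s) i z) <= G (lb s) by rewrite /set_coord Hz leNgt Hg.
by apply: increasing_le => // j; rewrite set_coordE; case: eqP => [->|].
Qed.

(** If objective [i] of [y] exceeded a finite [a], then [y] would lie above the axis point where [G]
    equals [gbest s] and could not improve. Rounding down is harmless because [obj c i y] is an
    integer. *)
Lemma axis_bound_ge s i a y : valid s -> sub_feasible A b c s y ->
  G (objs c y) < gbest s -> axis_bound G (gbest s) (lb s) i a ->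
  ((obj c i y)%:E <= er_map (fun r : R => (Num.floor r)%:~R : R) a)%E.
Proof.
move=> vs Dy yg; have ylb := lb_le vs Dy; have Xy := sub_feasibleS Dy.
case: a => [z| |] //= Hz; last by rewrite leey.
rewrite lee_fin -[obj c i y]floorK ?obj_int // ler_int floor_ge_int.
rewrite floorK ?obj_int // leNgt; apply/negP => zy.
suff: G (set_coord (lb s) i z) <= G (objs c y) by rewrite /set_coord Hz leNgt yg.
apply: increasing_le => // j; rewrite set_coordE !mxE.
by case: eqP => [->|_]; [exact: ltW|exact: ylb].
Qed.

Lemma valid_step1 s (fA : 'I_k.+1 -> \bar R) : valid s -> G (lb s) < gbest s ->
  (forall i, axis_bound G (gbest s) (lb s) i (fA i)) ->
  valid (State (gbest s) (xbest s) (lb s)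
         (fun i => Order.min
            (er_map (fun a : R => (Num.floor a)%:~R : R) (fA i)) (ub s i))).
Proof.
move=> vs Hg HfA; split=> /=.
- exact: xbest_feasible.
- exact: gbestE.
- move=> y Xy yg i; rewrite le_min (improving_in_box vs) // andbT.
  exact: axis_bound_ge (valid_improving vs Xy yg) yg (HfA i).
- move=> y Dy; apply: (lb_le vs); apply: bounded_by_ub Dy => i /=.
  by rewrite ge_min lexx orbT.
- exact: lb_int.
- move=> i; rewrite minEle; case: ifP => _; last exact: ub_int.
  by have := HfA i; case: (fA i) => [z _| |] //=; [right|left];
    first by exists (Num.floor z)%:~R => //; exact: intr_int.
Qed.

(* A point cut off by the new bound is dominated by a collected one. *)
Lemma valid_step3 s V v : valid s -> collected s V ->
  (forall x, lex_optimal A b c s x -> objs c x \in V) ->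
  v \in V -> (forall w, w \in V -> w 0 ord_max <= v 0 ord_max) ->
  valid (State (gbest s) (xbest s) (lb s)
         (fun i => if i == ord_max then (v 0 ord_max - 1)%:E else ub s i)).
Proof.
move=> vs cS Sall vS vmax.
have [_ [x0 x0lex Ev]] := cS v vS.
have Dx0 := lex_optimal_feasible x0lex.
have vint : v 0 ord_max \is a Num.int.
  by rewrite -Ev mxE; apply/obj_int/(sub_feasibleS Dx0).
(* As the collected [x0] lies in the box, the new bound only shrinks the box, so [lb_le]
   persists. *)
have vub : ((v 0 ord_max)%:E <= ub s ord_max)%E by rewrite -Ev mxE; apply: Dx0.2.
split=> /=.
- exact: xbest_feasible.
- exact: gbestE.
- move=> y Xy yg i; have Dy := valid_improving vs Xy yg.
  case: eqP => [->|_]; last exact: Dy.2.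
  rewrite lee_fin lerBrDr; apply: int_ltD1 => //; first exact: obj_int.
  rewrite ltNge; apply/negP => vy.
  have [x xlex xy] := lex_optimal_below Dy.
  have [gx _] := cS _ (Sall _ xlex).
  suff : G (objs c x) <= G (objs c y) by rewrite leNgt (lt_le_trans yg).
  apply: objs_le => j; have [->|/xy //] := eqVneq j ord_max.
  by apply: le_trans vy; have := vmax _ (Sall _ xlex); rewrite mxE.
- move=> y Dy; apply: (lb_le vs); apply: bounded_by_ub Dy => i /=.
  case: eqP => [->|//]; apply: le_trans vub.
  by rewrite lee_fin lerBlDr lerDl.
- exact: lb_int.
- move=> i; case: eqP => _; last exact: ub_int.
  by right; exists (v 0 ord_max - 1) => //; rewrite rpredB ?rpred1.
Qed.

(** Both stopping rules certify optimality: an improving point would lie in the box, hence above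
    [lb] in Step 1, and would make the box nonempty in Step 3. *)
Lemma valid_config_step cf cf' :
  step A b c G cf cf' -> valid_config cf -> valid_config cf'.
Proof.
case=> {cf cf'} /=.
- move=> I x y XI [Ix xmin] ymin _; split=> //=.
  + exact: XI.
  + by move=> *; rewrite leey.
  + by move=> z [Xz _] i; rewrite mxE; apply: (ymin i).2.
  + by move=> i; rewrite mxE; apply: obj_int; exact: (ymin i).1.
  + by move=> i; left.
- move=> s Hg vs; split=> // y Xy; rewrite leNgt; apply/negP => yg.
  have Dy := valid_improving vs Xy yg.
  suff: G (lb s) <= G (objs c y) by rewrite leNgt (lt_le_trans yg).
  by apply: increasing_le => // i; rewrite mxE; apply: lb_le.
- by move=> s fA Hg HfA vs; apply: valid_step1.
- by move=> s xs Hxs _ vs; apply: valid_step2.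
- by move=> s xs Hxs _ vs; split=> //; apply: valid_step2.
- move=> s Hn [vs _]; split=> // y Xy; rewrite leNgt; apply/negP => yg.
  by apply: Hn; exists y; apply: valid_improving.
- move=> s V x xlex _ xg [vs _]; split=> //=.
  + exact: sub_feasibleS (lex_optimal_feasible xlex).
  + move=> y Xy yx; apply: improving_in_box => //; exact: lt_trans xg.
  + exact: (lb_le vs).
  + exact: (lb_int vs).
  + exact: (ub_int vs).
- move=> s V x xlex _ xg [vs cS]; split=> // v.
  by rewrite inE => /predU1P[->|/cS //]; split=> //; exists x.
- by move=> s V v Sall vS vmax [vs cS]; apply: valid_step3 vmax.
Qed.

Lemma reachable_valid cf : reachable A b c G cf -> valid_config cf.
Proof.
have : valid_config (Start R n k) by [].
rewrite /reachable; move: (Start R n k) => cf0 v0 st.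
by elim: st v0 => // [? ? /valid_config_step //|? ? ? _ IH1 _ IH2 /IH1/IH2].
Qed.

Lemma valid_stopped_correct s : valid_config (Stopped s) ->
  is_minimum (fun x => G (objs c x)) (efficient c predT (feasible A b)) (gbest s) /\
  efficient c predT (feasible A b) (xbest s) /\ G (objs c (xbest s)) = gbest s.
Proof.
move=> [vs Hmin]; have E := gbestE vs.
have xeff : efficient c predT (feasible A b) (xbest s).
  split=> [|[y [Xy yx [i _ yi]]]]; first exact: xbest_feasible.
  suff: G (objs c y) < gbest s by rewrite ltNge Hmin.
  rewrite E; apply: increasing_lt => // [j|]; first by rewrite !mxE yx.
  by exists i; rewrite !mxE.
split; last by split.
by exists (xbest s) => //; split=> // y [Xy _]; rewrite -E; apply: Hmin.
Qed.

(** * Absence of deadlock *)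

Hypothesis X_nonempty : exists x, feasible A b x.
Hypothesis G_continuous : continuous G.

Lemma lp_outcome_exists s :
  exists xs, forall i, lp_outcome A b c s i (xs i).
Proof.
have /choice[xs Hxs] i : exists o, lp_outcome A b c s i o; last by exists xs.
case: (pselect (exists x, argmin (obj c i) (bounded_by c (ub s) (lp_feasible A b)) x)).
  by move=> [x Hx]; exists (Some x).
by move=> H; exists None.
Qed.

Lemma seq_max (T : eqType) (h : T -> R) (V : seq T) : V != [::] ->
  exists2 v, v \in V & forall w, w \in V -> h w <= h v.
Proof.
elim: V => // v [|u V] IH _; first by exists v => [|w]; rewrite inE // => /eqP ->.
have [//|w wS wmax] := IH.
have [vw|/ltW wv] := leP (h v) (h w).
  exists w => [|t]; rewrite inE ?wS ?orbT // => /predU1P[-> //|].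
  exact: wmax.
exists v => [|t]; rewrite inE ?eqxx // => /predU1P[-> //|/wmax tw].
exact: le_trans wv.
Qed.

Lemma progress cf : valid_config cf ->
  (exists s, cf = Stopped s) \/ exists cf', step A b c G cf cf'.
Proof.
case: cf => [|s|s|s V|s] /=; [| | | |by left; exists s] => vs; right.
- have [x0 Xx0] := X_nonempty.
  have /choice[y Hy] i := feasible_argmin i (@subset_refl _ (feasible A b)) X_nonempty.
  eexists; apply: (@Step0 _ _ _ _ _ _ _ _ [:: x0] x0 y) => //.
    by move=> z; rewrite inE => /eqP ->.
  split=> [|z] /=; first by rewrite inE.
  by rewrite inE => /eqP ->.
- have [Hg|Hg] := leP (gbest s) (G (lb s)).
    by eexists; exact: Step1_stop.
  have /choice[fA HfA] i := axis_bound_exists G_increasing G_continuous i Hg.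
  by eexists; apply: Step1_bound HfA.
- have [xs Hxs] := lp_outcome_exists s.
  have [E|ne] := eqVneq (lb (step2_state c G s xs)) (lb s).
    by eexists; apply: Step2_done Hxs E.
  by eexists; apply: Step2_again Hxs ne.
case: (pselect (exists2 x, lex_optimal A b c s x & objs c x \notin V)).
  move=> [x xlex xS]; have [Hg|Hg] := leP (gbest s) (G (objs c x)).
    by eexists; apply: Step3_collect xlex xS Hg.
  by eexists; apply: Step3_improve xlex xS Hg.
(* All lexicographic optima are now collected: Step 3 closes if [V] is nonempty; otherwise
   [lex_optimal_below] shows that the box has no feasible point. *)
move=> Hn.
have Sall x : lex_optimal A b c s x -> objs c x \in V.
  by move=> xlex; apply: contrapT => /negP xS; apply: Hn; exists x.
have [S0|Sne] := eqVneq V [::]; last first.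
  have [v vS vmax] := seq_max (fun w : 'rV[R]_k.+1 => w 0 ord_max) Sne.
  by eexists; apply: Step3_done Sall vS vmax.
exists (Stopped s); rewrite S0; apply: Step3_stop => -[y /lex_optimal_below[x /Sall]].
by rewrite S0 in_nil.
Qed.

(** * Effect of one step on the bounds *)

(** The state attached to [Start] is a placeholder, hence the side conditions [cf <> Start]
    below. *)
Definition config_state cf : state R n k :=
  match cf with
  | Start => State 0 0 0 (fun=> +oo%E)
  | AtStep1 s | AtStep2 s | AtStep3 s _ | Stopped s => s
  end.
Local Notation st := config_state.

Lemma step_le cf cf' : step A b c G cf cf' -> cf <> Start R n k -> valid_config cf ->
  gbest (st cf') <= gbest (st cf) /\ forall i, (ub (st cf') i <= ub (st cf) i)%E.
Proof.
case=> {cf cf'} //=.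
- by move=> s fA *; split=> // i; rewrite ge_min lexx orbT.
- by move=> s xs Hxs _ _ vs; have [_ _] := step2_best vs Hxs.
- by move=> s xs Hxs _ _ vs; have [_ _] := step2_best vs Hxs.
- by move=> s V x _ _ /ltW.
- move=> s V v _ vV _ _ [vs cV]; split=> // i; case: eqP => [->|//].
  have [_ [x /lex_optimal_feasible[_ xub] <-]] := cV v vV.
  by apply: le_trans (xub ord_max); rewrite mxE lee_fin lerBlDr lerDl.
Qed.

(** Step 1 keeps its bound above [lb], which is integral and so survives the floor; the [- 1] comes
    from Step 3, where [v] is at least [lb]. *)
Lemma step_ub_ge cf cf' i : step A b c G cf cf' -> cf <> Start R n k -> valid_config cf ->
  (Order.min (ub (st cf) i) (lb (st cf) 0 i - 1)%:E <= ub (st cf') i)%E.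
Proof.
case=> {cf cf'} //=; try by move=> *; rewrite ge_min lexx.
- move=> s fA Hg HfA _ vs; rewrite le_min ge_min orbC ge_min lexx /= andbT.
  apply/orP; left; apply: (@le_trans _ _ (lb s 0 i)%:E).
    by rewrite lee_fin lerBlDr lerDl.
  have := axis_bound_gt_lb Hg (HfA i); case: (fA i) => [z| |] //=.
  rewrite lte_fin lee_fin -[lb s 0 i]floorK ?(lb_int vs) // => /ltW.
  by rewrite ler_int floor_ge_int.
- move=> s V v _ vV _ _ [vs cV]; case: eqP => [->|_]; last by rewrite ge_min lexx.
  have [_ [x /lex_optimal_feasible Dx <-]] := cV v vV.
  rewrite ge_min; apply/orP; right; rewrite lee_fin mxE lerD2r.
  exact: (lb_le vs).
Qed.

(* [lb] is not monotone: the first LP outcome may fall below the integer optimum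
   computed in Step 0.  From then on it cannot decrease, since the boxes shrink;
   [lp_floor] is the invariant expressing this. *)
Definition lp_floor i (B : R) s : Prop :=
  B <= lb s 0 i /\ forall x, bounded_by c (ub s) (lp_feasible A b) x ->
    B <= (Num.ceil (obj c i x))%:~R.

Lemma step_lp_floor cf cf' i B : step A b c G cf cf' -> cf <> Start R n k ->
  valid_config cf -> lp_floor i B (st cf) -> lp_floor i B (st cf').
Proof.
move=> Hst ns vcf [Blb Bx]; have [_ Hub] := step_le Hst ns vcf; split; last first.
  by move=> x /(bounded_by_ub Hub); exact: Bx.
case: Hst ns Blb Bx {vcf Hub} => //= s xs Hxs _ _ Blb Bx.
  rewrite step2_lbE; have := Hxs i.
  by case: (xs i) => [x [Dx _]|//]; exact: Bx.
rewrite step2_lbE; have := Hxs i.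
by case: (xs i) => [x [Dx _]|//]; exact: Bx.
Qed.

Lemma step2_lp_floor s xs i : (forall i, lp_outcome A b c s i (xs i)) ->
  lb (step2_state c G s xs) 0 i = lb s 0 i \/
  exists B, lp_floor i B (step2_state c G s xs).
Proof.
move=> /(_ i); rewrite step2_lbE; case E: (xs i) => [x|] Hx; last by left.
right; exists (Num.ceil (obj c i x))%:~R; split; first by rewrite step2_lbE E.
by move=> y Dy; rewrite ler_int; apply/le_ceil/Hx.2.
Qed.

Lemma step_lb cf cf' i : step A b c G cf cf' -> cf <> Start R n k ->
  lb (st cf') 0 i = lb (st cf) 0 i \/ exists B, lp_floor i B (st cf').
Proof.
case=> {cf cf'} //=; try by left.
- by move=> s xs Hxs _ _; exact: step2_lp_floor.
- by move=> s xs Hxs _ _; exact: step2_lp_floor.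
Qed.

(* Once the upper bounds are stationary, the LP optima are too, so after one
   more pass through Step 2 the lower bounds no longer change. *)
Definition lp_settled s : Prop := forall i x,
  argmin (obj c i) (bounded_by c (ub s) (lp_feasible A b)) x ->
  lb s 0 i = (Num.ceil (obj c i x))%:~R.

(** An LP may have several optimal solutions, but they share their value. *)
Lemma step2_settled s xs : (forall i, lp_outcome A b c s i (xs i)) ->
  lp_settled (step2_state c G s xs).
Proof.
move=> Hxs i x [Dx xmin]; rewrite step2_lbE; have := Hxs i.
case: (xs i) => [y [Dy ymin]|Hn]; last by case: Hn; exists x.
congr (Num.ceil _)%:~R; apply/eqP.
by rewrite eq_le ymin // xmin.
Qed.

Lemma settled_step2 s xs : lp_settled s -> (forall i, lp_outcome A b c s i (xs i)) ->
  lb (step2_state c G s xs) = lb s.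
Proof.
move=> Hs Hxs; apply/rowP => i; rewrite step2_lbE; have := Hxs i.
by case: (xs i) => [y /Hs|].
Qed.

(** Steps that lower [gbest] or close Step 3 are excluded. Since Step 2 returns to Step 1 only from
    an unsettled state and settles it, this loop cannot repeat. *)
Lemma quiet_step cf cf' : step A b c G cf cf' -> valid_config cf ->
  gbest (st cf') = gbest (st cf) -> (forall i, ub (st cf') i = ub (st cf) i) ->
  match cf with
  | AtStep1 s => (exists s', cf' = Stopped s') \/
      exists2 s', cf' = AtStep2 s' & lp_settled s -> lp_settled s'
  | AtStep2 s => (exists s' V, cf' = AtStep3 s' V) \/
      exists s', [/\ cf' = AtStep1 s', lp_settled s' & ~ lp_settled s]
  | AtStep3 s V => (exists s', cf' = Stopped s') \/
      exists x, [/\ lex_optimal A b c s x, objs c x \notin V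
                  & cf' = AtStep3 s (objs c x :: V)]
  | _ => True
  end.
Proof.
case=> {cf cf'} //=.
- by move=> s *; left; exists s.
- move=> s fA _ _ _ _ Hub; right; eexists; first by [].
  move=> Hs i x [Dx xmin]; apply: Hs; split.
    by apply: bounded_by_ub Dx => j; rewrite /= Hub.
  by move=> y Dy; apply: xmin; apply: bounded_by_ub Dy => j; rewrite /= Hub.
- move=> s xs Hxs /eqP ne _ _ _; right; eexists; split; first by [].
    exact: step2_settled.
  by move=> Hs; apply: ne; exact: settled_step2.
- by move=> s xs Hxs *; left; do 2!eexists.
- by move=> s *; left; exists s.
- by move=> s V x _ _ xg _ E; rewrite E ltxx in xg.
- by move=> s V x *; right; exists x.
move=> s V v _ vV _ [vs cV] _ /(_ ord_max); rewrite eqxx => Hub.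
have [_ [x /lex_optimal_feasible[_ /(_ ord_max) xub] Ev]] := cV v vV.
by move: xub; rewrite -Hub -Ev mxE lee_fin lerBrDr gerDl leNgt ltr01.
Qed.

Lemma step_stopped s cf : ~ step A b c G (Stopped s) cf.
Proof. by move E: (Stopped s) => cf0 H; case: H E. Qed.

Lemma step_start cf : ~ step A b c G cf (Start R n k).
Proof. by move E: (Start R n k) => cf0 H; case: H E. Qed.

(** * Impossibility of an infinite run *)

Section Run.
Variable cfg : nat -> config R n k.
Hypothesis cfg_step : forall t, step A b c G (cfg t) (cfg t.+1).
Hypothesis cfg_started : forall t, cfg t <> Start R n k.
Hypothesis cfg_valid : forall t, valid_config (cfg t).

Let sq t := st (cfg t).

Lemma run_valid t : valid (sq t).
Proof.
have := cfg_valid t; have := @cfg_started t; rewrite /sq.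
by case: (cfg t) => //= [s V _ []|s _ []].
Qed.

Lemma run_gbest p q : (p <= q)%N -> gbest (sq q) <= gbest (sq p).
Proof.
move=> /subnK <-; elim: (q - p)%N => [//|N]; apply: le_trans.
exact: (step_le (cfg_step _) (@cfg_started _) (cfg_valid _)).1.
Qed.

Lemma run_gbest_constant :
  exists T, forall t, (T <= t)%N -> gbest (sq t) = gbest (sq T).
Proof.
have /choice[l Hl] := obj_bounded_below.
have [||phi [phiS Hphi]] := @dickson R 'I_k.+1 (fun t i => obj c i (xbest (sq t))) l.
- by move=> t i; apply/obj_int/xbest_feasible/run_valid.
- by move=> t i; apply/Hl/xbest_feasible/run_valid.
have phi_ge t : (t <= phi t)%N.
  by elim: t => // t IH; apply: leq_ltn_trans IH (phiS _ _ (ltnSn t)).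
(* Since [t <= phi t], the value at [t] is at least that at [phi t], which by monotonicity of [G]
   along [phi] is at least that at [phi 0]. *)
exists (phi 0%N) => t pt; apply/eqP; rewrite eq_le run_gbest //=.
apply: le_trans (run_gbest (phi_ge t)).
rewrite !(gbestE (run_valid _)); apply: objs_le => i; exact: Hphi.
Qed.

(** Either some [lp_floor] holds at some time and is preserved afterwards, or [lb] never changes in
    coordinate [i]. *)
Lemma run_lb_bounded i : exists B T, forall t, (T <= t)%N -> B <= lb (sq t) 0 i.
Proof.
case: (pselect (exists T B, lp_floor i B (sq T))) => [[T [B HB]]|Hn].
  exists B, T => t /subnK <-.
  suff [] : lp_floor i B (sq (t - T + T)) by [].
  elim: (t - T)%N => [//|N]; exact: step_lp_floor.
exists (lb (sq 0%N) 0 i), 0%N => t _; elim: t => // t IH.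
have [E|HB] := step_lb i (cfg_step t) (@cfg_started t); first by rewrite /sq E.
by case: Hn; exists t.+1.
Qed.

Lemma run_ub_constant i :
  exists T, forall t, (T <= t)%N -> ub (sq t) i = ub (sq T) i.
Proof.
have [B [T0 HB]] := run_lb_bounded i.
(* [L] lies below both terms of the minimum in [step_ub_ge], so it stays below the upper bound by
   induction. *)
have [L [LT LB]] : exists L : R, (L%:E <= ub (sq T0) i)%E /\ L <= B - 1.
  have [E|[z _ E]] := ub_int (run_valid T0) i; rewrite E.
    by exists (B - 1); rewrite leey.
  by exists (Num.min z (B - 1)); rewrite lee_fin !ge_min !lexx orbT.
apply: (@int_ereal_eventually_constant _ (fun t => ub (sq t) i) L T0) => t.
- exact: (step_le (cfg_step _) (@cfg_started _) (cfg_valid _)).2.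
- exact: (ub_int (run_valid t)).
move=> /subnK <-; elim: (t - T0)%N => [//|N IH].
apply: (le_trans _ (step_ub_ge i (cfg_step _) (@cfg_started _) (cfg_valid _))).
rewrite le_min IH /= lee_fin (le_trans LB) // lerD2r.
by apply: HB; exact: leq_addl.
Qed.

Lemma run_quiet : exists T, forall t, (T <= t)%N ->
  gbest (sq t.+1) = gbest (sq t) /\ forall i, ub (sq t.+1) i = ub (sq t) i.
Proof.
have [T1 H1] := run_gbest_constant; have /choice[T2 H2] := run_ub_constant.
exists (maxn T1 (\max_i T2 i)) => t; rewrite geq_max => /andP[Tt /bigmax_leqP Ht].
split=> [|i]; first by rewrite !H1 // ltnW.
have Tit : (T2 i <= t)%N by exact: Ht.
by rewrite (H2 i t.+1) ?(H2 i t) // ltnW.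
Qed.

Lemma run_not_stopped t s : cfg t <> Stopped s.
Proof. by move=> E; have := cfg_step t; rewrite E => /step_stopped. Qed.

(** In the quiet regime Step 2 sends the run back to Step 1 at most once, as the state is then
    settled; so Step 3 is reached and only collecting remains. *)
Lemma no_run : False.
Proof.
have [T HT] := run_quiet.
have Q t : (T <= t)%N -> _ := fun Tt =>
  quiet_step (cfg_step t) (cfg_valid t) (HT t Tt).1 (HT t Tt).2.
have at2 t s : (T <= t)%N -> cfg t = AtStep2 s -> lp_settled s ->
    exists s' V, cfg t.+1 = AtStep3 s' V.
  by move=> Tt E Hs; have := Q t Tt; rewrite E => -[//|[s' [_ _ /(_ Hs)]]].
have at1 t s : (T <= t)%N -> cfg t = AtStep1 s ->
    exists2 s', cfg t.+1 = AtStep2 s' & lp_settled s -> lp_settled s'.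
  by move=> Tt E; have := Q t Tt; rewrite E => -[[s' /run_not_stopped]|].
have at1s t s : (T <= t)%N -> cfg t = AtStep1 s -> lp_settled s ->
    exists t' s' V, (T <= t')%N /\ cfg t' = AtStep3 s' V.
  move=> Tt /(at1 _ _ Tt)[s' E Hs] /Hs; have Tt' := leqW Tt.
  by move=> /(at2 _ _ Tt' E)[s2 [V E2]]; exists t.+2, s2, V; rewrite !leqW.
have at2u t s : (T <= t)%N -> cfg t = AtStep2 s ->
    exists t' s' V, (T <= t')%N /\ cfg t' = AtStep3 s' V.
  move=> Tt E; have := Q t Tt; rewrite E => -[[s' [V E']]|[s' [E' Hs _]]].
    by exists t.+1, s', V; rewrite leqW.
  exact: at1s (leqW Tt) E' Hs.
have [T3 [s [V0 [TT3 E0]]]] : exists t s V, (T <= t)%N /\ cfg t = AtStep3 s V.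
  case E: (cfg T) => [|s|s|s V|s].
  - by case: (@cfg_started T).
  - have [s' E' _] := at1 _ _ (leqnn T) E; exact: at2u (leqW (leqnn T)) E'.
  - exact: at2u (leqnn T) E.
  - by exists T, s, V.
  - by case: (run_not_stopped E).
have Hcollect t V : (T <= t)%N -> cfg t = AtStep3 s V ->
    exists x, [/\ lex_optimal A b c s x, objs c x \notin V
                & cfg t.+1 = AtStep3 s (objs c x :: V)].
  by move=> Tt E; have := Q t Tt; rewrite E => -[[s' /run_not_stopped]|].
have TT3N N : (T <= T3 + N)%N by rewrite (leq_trans TT3) ?leq_addr.
have /choice[V HV] N : exists V, cfg (T3 + N) = AtStep3 s V.
  elim: N => [|N [V E]]; first by exists V0; rewrite addn0.
  have [x [_ _ E']] := Hcollect _ _ (TT3N N) E.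
  by rewrite addnS; exists (objs c x :: V).
(* Collecting does not alter [s], so all the [x N] are lexicographic optima of the same box. *)
have /choice[x Hx] N : exists x, [/\ lex_optimal A b c s x, objs c x \notin V N
    & V N.+1 = objs c x :: V N].
  have [x [x1 x2]] := Hcollect _ _ (TT3N N) (HV N).
  by rewrite -addnS HV => -[E]; exists x.
have xV p q : (p < q)%N -> objs c (x p) \in V q.
  elim: q => // q IH; have [_ _ ->] := Hx q.
  by rewrite ltnS inE leq_eqVlt => /predU1P[->|/IH ->]; rewrite ?eqxx ?orbT.
have xlex N : lex_optimal A b c s (x N) by have [] := Hx N.
have Dx N : sub_feasible A b c s (x N) := lex_optimal_feasible (xlex N).
have /choice[l Hl] := obj_bounded_below.
have [||phi [phiS Hphi]] := @dickson R 'I_k.+1 (fun t i => obj c i (x t)) l.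
- by move=> t i; apply/obj_int/(sub_feasibleS (Dx t)).
- by move=> t i; apply/Hl/(sub_feasibleS (Dx t)).
(* [x (phi 0)] is weakly below the efficient [x (phi 1)], so their vectors agree, although the
   second was absent from a list containing the first. *)
have [_ xnew _] := Hx (phi 1%N); have := xV _ _ (phiS 0%N 1%N isT).
have [_ xeff] := lex_optimal_efficient (xlex (phi 1%N)).
suff -> : objs c (x (phi 0%N)) = objs c (x (phi 1%N)) by apply/negP.
apply/rowP => i; rewrite !mxE; apply/eqP; rewrite eq_le Hphi //= leNgt.
apply/negP => xi; apply: xeff; exists (x (phi 0%N)); split=> // [j _|].
  exact: Hphi.
by exists i.
Qed.

End Run.

End Algorithm.

Theorem theorem1 (R : realType) (m n k : nat)
    (A : 'M[R]_(m, n)) (b : 'cV[R]_m) (c : 'M[int]_(k.+1, n))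
    (G : 'rV[R]_k.+1 -> R)
    (X_nonempty : exists x, feasible A b x)
    (obj_bounded_below : forall i, exists l : R,
       forall x, feasible A b x -> l <= obj c i x)
    (G_continuous : continuous G)
    (G_increasing : increasing_in_each G) :
  (* there is no infinite run *)
  (~ exists run : nat -> config R n k,
       run 0%N = Start R n k /\
       forall t, step A b c G (run t) (run t.+1)) /\
  (* a run can only end by stopping *)
  (forall cf, reachable A b c G cf ->
     (exists s, cf = Stopped s) \/ (exists cf', step A b c G cf cf')) /\
  (* when it stops, the result is correct *)
  (forall s, reachable A b c G (Stopped s) ->
     is_minimum (fun x => G (objs c x))
       (efficient c predT (feasible A b)) (gbest s) /\
     efficient c predT (feasible A b) (xbest s) /\
     G (objs c (xbest s)) = gbest s).
Proof.
split; last split.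
- move=> [run [run0 runS]].
  have runV t : valid_config A b c G (run t).
    by elim: t => [|t IH]; [rewrite run0|exact: valid_config_step (runS t) IH].
  (* The run is shifted by one to skip [Start], to which no step returns. *)
  apply: (@no_run _ _ _ _ A b c G obj_bounded_below G_increasing
            (fun t => run t.+1)) => // t E.
  by have := runS t; rewrite E => /step_start.
- by move=> cf /reachable_valid H; apply: progress (H _ _).
- by move=> s /reachable_valid H; apply: valid_stopped_correct => //; exact: H.
Qed.
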